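(* Let $0<p<1$ and let $G_n\in G(n,p)$ be independent random graphs (on $n$ vertices, each edge present independently with probability $p$). Then $(G_n)_{n\in\mathbb N}$ is almost surely FO-convergent.
   Context: For a first-order graph formula $\phi$ with free variables among $x_1,\dots,x_q$ and a finite graph $G$, $\langle\phi,G\rangle=|\{(v_1,\dots,v_q)\in V(G)^q:G\models\phi(v_1,\dots,v_q)\}|/|G|^q$. A sequence $(G_n)$ is FO-convergent if $\langle\phi,G_n\rangle$ converges for every first-order formula $\phi$. *)

(* Defs.v *)
From HB Require Import structures.
From mathcomp Require Import all_boot all_order all_algebra.
From mathcomp Require Import all_classical all_reals all_analysis.
Set Implicit Arguments. Unset Strict Implicit. Unset Printing Implicit Defensive.
Import Order.TTheory GRing.Theory Num.Theory.
Import numFieldNormedType.Exports.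
Local Open Scope classical_set_scope.
Local Open Scope ring_scope.

(* First-order formulas in the language of graphs; variables are nats
   (x_1, ..., x_q of the paper are the variables 0, ..., q-1). *)
Inductive formula : Type :=
  | FTrue : formula
  | FFalse : formula
  | FAdj : nat -> nat -> formula
  | FEq : nat -> nat -> formula
  | FNot : formula -> formula
  | FAnd : formula -> formula -> formula
  | FOr : formula -> formula -> formula
  | FImp : formula -> formula -> formula
  | FEx : nat -> formula -> formula
  | FAll : nat -> formula -> formula.

Fixpoint free (phi : formula) (x : nat) : bool :=
  match phi with
  | FTrue | FFalse => false
  | FAdj a b | FEq a b => (x == a) || (x == b)
  | FNot f => free f x
  | FAnd f g | FOr f g | FImp f g => free f x || free g x
  | FEx y f | FAll y f => (x != y) && free f x
  end.

Definition free_among (q : nat) (phi : formula) : Prop :=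
  forall x, free phi x -> (x < q)%N.

Definition upd (T : Type) (env : nat -> option T) (x : nat) (t : T) :=
  fun y => if y == x then Some t else env y.

(* satisfaction in the graph (T, E); unassigned variables make atoms false *)
Fixpoint sat (T : finType) (E : rel T) (env : nat -> option T) (phi : formula)
  : bool :=
  match phi with
  | FTrue => true
  | FFalse => false
  | FAdj a b => match env a, env b with
                | Some u, Some v => E u v | _, _ => false end
  | FEq a b => match env a, env b with
                | Some u, Some v => u == v | _, _ => false end
  | FNot f => ~~ sat E env f
  | FAnd f g => sat E env f && sat E env g
  | FOr f g => sat E env f || sat E env g
  | FImp f g => sat E env f ==> sat E env g
  | FEx y f => [exists t : T, sat E (upd env y t) f]
  | FAll y f => [forall t : T, sat E (upd env y t) f]
  end.

Definition env_of (T : Type) (q : nat) (v : {ffun 'I_q -> T}) : nat -> option T :=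
  fun i => match @insub _ (fun i => (i < q)%N) 'I_q i with
           | Some j => Some (v j) | None => None end.

Definition stone (R : realType) (q : nat) (phi : formula) (T : finType) (E : rel T)
  : R :=
  (#|[set v : {ffun 'I_q -> T} | sat E (env_of v) phi]|)%:R / (#|T| ^ q)%:R.

Definition FO_convergent (R : realType) (G : forall n : nat, rel 'I_n) : Prop :=
  forall (q : nat) (phi : formula), free_among q phi ->
    cvg ((fun n => stone R q phi (G n)) @ \oo).

(* index of potential edges {u,v} (u < v) of the n-th graph *)
Definition edge_index := {n : nat & ('I_n * 'I_n)%type}.
Definition proper_pair (i : edge_index) : bool := ((tagged i).1 < (tagged i).2)%N.

Definition edge_event (Omega : Type) (G : forall n : nat, Omega -> rel 'I_n)
  (i : edge_index) : set Omega :=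
  [set w | G (tag i) w (tagged i).1 (tagged i).2].

Definition mutually_independent (d : measure_display) (Omega : measurableType d)
  (R : realType) (P : probability Omega R) (I : eqType) (J : pred I)
  (A : I -> set Omega) : Prop :=
  forall s : seq I, uniq s -> all J s ->
    P (\big[setI/setT]_(i <- s) A i) = (\prod_(i <- s) P (A i))%E.

(* Main.v *)
(* Fix a k-set A of vertices and B included in A. For the vertices v outside A, the
   events "v is adjacent in A exactly to the vertices of B" are independent of
   probability p^|B| (1-p)^(k-|B|), so by a Chernoff bound, a union bound over (A, B)
   and Borel-Cantelli, almost surely all these counts are asymptotically the expected
   ones, uniformly in (A, B). The rest is deterministic. The counts being positive
   gives the extension axioms, hence by a back-and-forth argument whether a tuple
   satisfies a formula eventually depends only on its adjacency type (in the same way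
   for all n). The density of each set of types of tuples of distinct vertices
   converges, by adding the vertices one at a time, and tuples with repetitions are
   negligible. *)

Require Import Defs.
From HB Require Import structures.
From mathcomp Require Import all_boot all_order all_algebra.
From mathcomp Require Import all_classical all_reals all_analysis.
From mathcomp Require Import ring lra.
Set Implicit Arguments. Unset Strict Implicit. Unset Printing Implicit Defensive.
Import Order.TTheory GRing.Theory Num.Theory.
Import numFieldNormedType.Exports.
Local Open Scope classical_set_scope.
Local Open Scope ring_scope.

(** * Chernoff bound *)

(** Expanding the product over subsets [S] of [C] leaves the joint moments [pi ^+ #|S|], and the
    same expansion read backwards gives the power. With [a = expR t - 1] this is the moment
    generating function of a binomial variable. *)
Lemma sum_weight_prod (R : comPzRingType) (T V : finType) (wt : T -> R)
    (h : V -> pred T) (C : {set V}) (pi a : R) :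
  (forall S : {set V}, S \subset C ->
    \sum_(g | [forall v in S, h v g]) wt g = pi ^+ #|S|) ->
  \sum_g wt g * \prod_(v in C) (1 + a * (h v g)%:R) = (1 + a * pi) ^+ #|C|.
Proof.
move=> hpi.
have distr (F : V -> R) : \prod_(v in C) (1 + F v)
    = \sum_(S : {set V}) \prod_(v in S) ((v \in C)%:R * F v).
  rewrite big_mkcond.
  under eq_bigr => v _.
    have -> : (if v \in C then 1 + F v else 1) = (v \in C)%:R * F v + 1.
      by case: (v \in C); rewrite ?mul1r ?mul0r ?add0r // addrC.
    over.
  rewrite bigA_distr; apply: eq_bigr => S _.
  by rewrite [RHS]big_mkcond.
rewrite -prodr_const distr.
under eq_bigr => g _ do rewrite distr mulr_sumr.
rewrite exchange_big; apply: eq_bigr => S _ /=.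
have [SC|/subsetPn[v vS vC]] := boolP (S \subset C); last first.
  rewrite (bigD1 v) //= (negbTE vC) !mul0r; apply: big1 => g _.
  by rewrite (bigD1 v) //= (negbTE vC) !mul0r mulr0.
under eq_bigr => g _.
  have -> : \prod_(v in S) ((v \in C)%:R * (a * (h v g)%:R))
      = a ^+ #|S| * [forall v in S, h v g]%:R.
    under eq_bigr => v vS do rewrite (fintype.subsetP SC _ vS) mul1r.
    rewrite big_split /= prodr_const; congr (_ * _).
    have [/forall_inP hS|/forall_inPn[v vS hv]] := boolP [forall v in S, h v g].
      by rewrite big1 // => v vS; rewrite hS.
    by rewrite (bigD1 v) //= (negbTE hv) mul0r.
  over.
under [RHS]eq_bigr => v vS do rewrite (fintype.subsetP SC _ vS) mul1r.
rewrite prodr_const exprMn -(hpi S SC) mulr_sumr [RHS]big_mkcond.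
apply: eq_bigr => g _; case: ifP => _; last by rewrite !mulr0.
by rewrite mulr1 mulrC.
Qed.

(** From [expR (- t) >= 1 - t] one gets [expR t <= (1 - t)^-1], and the quadratic times [1 - t] is
    [1 + t ^+ 2 * (1 - 2 * t) >= 1]. *)
Lemma expR_le_quadratic (R : realType) (t : R) :
  t <= 1 / 2 -> expR t <= 1 + t + 2 * t ^+ 2.
Proof.
move=> t2; have t1 : 0 < 1 - t by lra.
have := expR_ge1Dx (- t); rewrite expRN => h.
have et : expR t <= (1 - t)^-1.
  by rewrite -[expR t]invrK lef_pV2 ?posrE ?invr_gt0 ?expR_gt0.
apply: le_trans et _; rewrite -[leLHS]mul1r ler_pdivrMr //.
have -> : (1 + t + 2 * t ^+ 2) * (1 - t) = 1 + t ^+ 2 * (1 - 2 * t) by ring.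
by rewrite lerDl mulr_ge0 ?sqr_ge0 //; lra.
Qed.

(* Markov's inequality for [expR (t * X)]; the sign of [t] selects the tail. *)
Lemma chernoff_weight (R : realType) (T V : finType) (wt : T -> R)
    (h : V -> pred T) (C : {set V}) (pi t e : R) :
  (forall g, 0 <= wt g) -> 0 <= pi <= 1 -> 0 <= e <= 1 ->
  `|t| = e / 4 ->
  (forall S : {set V}, S \subset C ->
    \sum_(g | [forall v in S, h v g]) wt g = pi ^+ #|S|) ->
  \sum_(g | `|t| * e * #|C|%:R
      <= t * (#|[pred v in C | h v g]|%:R - pi * #|C|%:R)) wt g
    <= expR (- (e ^+ 2 / 8) * #|C|%:R).
Proof.
move=> wt0 /andP[pi0 pi1] /andP[e0 e1] te hpi.
set m : R := #|C|%:R; have m0 : 0 <= m by rewrite ler0n.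
(* Each factor [1 + (expR t - 1) * h v g] is [expR t] or [1], so their product over [C] is the
   exponential of [t] times the count. *)
have mgf : \sum_g wt g * expR (t * #|[pred v in C | h v g]|%:R)
    = (1 + (expR t - 1) * pi) ^+ #|C|.
  rewrite -(sum_weight_prod _ hpi); apply: eq_bigr => g _; congr (_ * _).
  rewrite mulrC expRM_natl -prodr_const.
  rewrite [RHS](bigID (fun v => h v g)) /= [X in _ * X]big1 ?mulr1; last first.
    by move=> v /andP[_ /negbTE ->]; rewrite mulr0 addr0.
  rewrite (eq_bigl (fun v => (v \in C) && h v g)); last by move=> v; rewrite inE.
  by apply: eq_bigr => v /andP[_ ->]; rewrite mulr1 addrC subrK.
pose c := t * pi * m + `|t| * e * m.
apply: (@le_trans _ _
  (\sum_g wt g * expR (t * #|[pred v in C | h v g]|%:R) * expR (- c))).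
  rewrite big_mkcond; apply: ler_sum => g _; case: ifP => hg; last first.
    by rewrite !mulr_ge0 ?expR_ge0.
  rewrite -mulrA -expRD ler_peMr //; apply: le_trans (expR_ge1Dx _).
  by rewrite lerDl /c; move: hg; rewrite -/m; lra.
rewrite -mulr_suml mgf.
have t2 : t <= 1 / 2 by have := ler_norm t; lra.
have tt : t ^+ 2 = (e / 4) ^+ 2 by rewrite -te real_normK ?num_real.
have base0 : 0 <= 1 + (expR t - 1) * pi.
  by have := expR_ge0 t; nra.
have base : 1 + (expR t - 1) * pi <= expR (t * pi + 2 * t ^+ 2).
  apply: le_trans (expR_ge1Dx _); have := expR_le_quadratic t2.
  have := sqr_ge0 t; nra.
apply: le_trans (_ : expR (t * pi + 2 * t ^+ 2) ^+ #|C| * expR (- c) <= _).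
  by rewrite ler_wpM2r ?expR_ge0 // lerXn2r ?nnegrE ?expR_ge0.
(* The terms [t * pi * m] cancel; with [|t| = e / 4] the rest is [2 t^2 m - |t| e m = (e^2 / 8 - e^2
   / 4) m]. *)
rewrite -expRM_natl -expRD ler_expR -/m /c te tt; nra.
Qed.

Lemma measurable_preimage_pred d (Omega : measurableType d) (T : finType)
    (X : Omega -> T) (Q : pred T) :
  (forall g, measurable (X @^-1` [set g])) -> measurable [set w | Q (X w)].
Proof.
move=> mX.
have -> : [set w | Q (X w)] = \bigcup_(g in [set` Q]) X @^-1` [set g].
  by apply/seteqP; split => [w Qw|w [g Qg /= ->]] //; exists (X w).
by apply: fin_bigcup_measurable => //; exact: finite_finset.
Qed.

Lemma measure_preimage_pred d (Omega : measurableType d) (R : realType)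
    (P : probability Omega R) (T : finType) (X : Omega -> T) (Q : pred T) :
  (forall g, measurable (X @^-1` [set g])) ->
  P [set w | Q (X w)] = (\sum_(g | Q g) P (X @^-1` [set g]))%E.
Proof.
move=> mX.
have -> : [set w | Q (X w)] = \bigcup_(g in [set` Q]) X @^-1` [set g].
  by apply/seteqP; split => [w Qw|w [g Qg /= ->]] //; exists (X w).
rewrite measure_fin_bigcup //; first last.
- by move=> g g' _ _ [w [/= Xg Xg']]; rewrite -Xg -Xg'.
rewrite (bigfs _ (index_enum_uniq T)) // => g _.
by rewrite mem_index_enum.
Qed.

Lemma chernoff (d : measure_display) (Omega : measurableType d) (R : realType)
    (P : probability Omega R) (V : finType) (C : {set V}) (H : V -> set Omega)
    (pi e : R) :
  (forall v, measurable (H v)) -> 0 <= pi <= 1 -> 0 < e <= 1 ->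
  (forall S : {set V}, S \subset C ->
    P (\bigcap_(v in [set` S]) H v) = (pi ^+ #|S|)%:E) ->
  let bad := [set w | e * #|C|%:R
    < `|#|[pred v in C | w \in H v]|%:R - pi * #|C|%:R|] in
  measurable bad /\ (P bad <= (2 * expR (- (e ^+ 2 / 8) * #|C|%:R))%:E)%E.
Proof.
move=> mH pi01 /andP[e0 e1] HP bad.
(* The vector of indicators takes finitely many values, so probabilities of events about the count
   become finite sums of the weights [wt]. *)
pose X w := [ffun v => w \in H v].
have mX g : measurable (X @^-1` [set g]).
  have -> : X @^-1` [set g] =
      \bigcap_(v in [set: V]) (if g v then H v else ~` H v).
    apply/seteqP; split => w.
      move=> <- v _; rewrite ffunE; case: ifPn; first by rewrite inE.
      by rewrite notin_setE.
    move=> wH; apply/ffunP => v; rewrite ffunE; have := wH v I.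
    by case: (g v) => [/mem_set //|/= wHv]; apply/negbTE; rewrite notin_setE.
  apply: fin_bigcap_measurable; first exact: finite_finset.
  by move=> v _; case: (g v) => //; exact: measurableC.
pose wt g := fine (P (X @^-1` [set g])).
have PQ (Q : pred {ffun V -> bool}) :
    P [set w | Q (X w)] = (\sum_(g | Q g) wt g)%:E.
  rewrite measure_preimage_pred // -sumEFin; apply: eq_bigr => g _.
  by rewrite fineK // fin_num_measure.
have wt0 g : 0 <= wt g by rewrite fine_ge0.
have hpi (S : {set V}) : S \subset C ->
    \sum_(g : {ffun V -> bool} | [forall v in S, g v]) wt g = pi ^+ #|S|.
  move=> /HP PS; apply: EFin_inj; rewrite -PS -PQ; congr (P _).
  apply/seteqP; split => w.
    by move=> /forall_inP h v /h; rewrite ffunE inE.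
  by move=> h; apply/forall_inP => v /h vH; rewrite ffunE inE.
pose dev (g : {ffun V -> bool}) : R :=
  #|[pred v in C | g v]|%:R - pi * #|C|%:R.
have badE : bad = [set w | e * #|C|%:R < `|dev (X w)|].
  apply: eq_set => w; rewrite /dev; do 4 f_equal.
  by congr (_%:R); apply: eq_card => v; rewrite !inE /= ffunE.
split.
  by rewrite badE; apply: (@measurable_preimage_pred _ _ _ X (fun g => e * #|C|%:R < `|dev g|)).
rewrite badE (PQ (fun g => e * #|C|%:R < `|dev g|)) lee_fin.
pose t := e / 4; have t0 : 0 < t by rewrite divr_gt0.
have e01 : 0 <= e <= 1 by rewrite ltW.
have up := chernoff_weight wt0 pi01 e01 (gtr0_norm t0) hpi.
have tN : `|- t| = e / 4 by rewrite normrN gtr0_norm.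
have dn := chernoff_weight wt0 pi01 e01 tN hpi.
(* The factor 2 pays for the two tails, [t] and [- t]: a large deviation belongs to at least one of
   them. *)
rewrite [leRHS]mulr_natl mulr2n; apply: le_trans (lerD up dn).
rewrite [leLHS]big_mkcond [X in _ <= X + _]big_mkcond [X in _ <= _ + X]big_mkcond.
rewrite -big_split; apply: ler_sum => g _ /=.
rewrite -/(dev g) normrN (gtr0_norm t0).
case: ifP => [|_]; last by apply: addr_ge0; case: ifP.
rewrite lter_normr => /orP[] /ltW h.
  rewrite -mulrA ler_pM2l // h lerDl; by case: ifP.
have -> : t * e * #|C|%:R <= - t * dev g by rewrite mulNr -mulrN -mulrA ler_pM2l.
by rewrite lerDr; case: ifP.
Qed.

(** * Extension events in the random graph *)

(** Induction on [t]: removing [A i] from an event subtracts the probability of the intersection,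
    where [i] has moved to the list [s] of positive events. *)
Lemma independent_complement (d : measure_display) (Omega : measurableType d)
    (R : realType) (P : probability Omega R) (I : eqType) (J : pred I)
    (A : I -> set Omega) (p : R) (s t : seq I) :
  (forall i, measurable (A i)) -> (forall i, J i -> P (A i) = p%:E) ->
  mutually_independent P J A -> uniq (s ++ t) -> all J (s ++ t) ->
  P (\big[setI/setT]_(i <- s) A i `&` \big[setI/setT]_(i <- t) ~` A i)
    = (p ^+ size s * (1 - p) ^+ size t)%:E.
Proof.
move=> mA PA indA; elim: t s => [|i t IHt] s.
  rewrite cats0 big_nil setIT expr0 mulr1 => us Js; rewrite indA //.
  elim: s Js {us} => [|j s IHs] /=; first by rewrite big_nil expr0.
  by case/andP => Jj Js; rewrite big_cons IHs // PA // exprS EFinM.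
move=> ust Jst.
have ust' : uniq (i :: s ++ t) by rewrite -(perm_uniq (permEl (perm_catCA s [:: i] t))).
have Jst' : all J (i :: s ++ t) by rewrite -(perm_all _ (permEl (perm_catCA s [:: i] t))).
rewrite big_cons.
set Y := \big[setI/setT]_(j <- s) A j; set Z := \big[setI/setT]_(j <- t) _.
have mY : measurable Y by exact: bigsetI_measurable.
have mZ : measurable Z.
  by apply: bigsetI_measurable => j _; exact: measurableC.
have -> : Y `&` (~` A i `&` Z) = (Y `&` Z) `\` A i by rewrite setDE setIAC setIA.
have -> : P ((Y `&` Z) `\` A i) = (P (Y `&` Z) - P (Y `&` Z `&` A i))%E.
  apply: measureD => //; first exact: measurableI.
  by rewrite -ge0_fin_numE ?fin_num_measure //; exact: measurableI.
have -> : P (Y `&` Z) = (p ^+ size s * (1 - p) ^+ size t)%:E.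
  by apply: IHt; [case/andP: ust' | case/andP: Jst'].
have -> : Y `&` Z `&` A i = \big[setI/setT]_(j <- i :: s) A j `&` Z.
  by rewrite big_cons -/Y setIC setIA.
by rewrite IHt // -EFinB /= !exprS; congr EFin; ring.
Qed.

Section Extensions.
Context (d : measure_display) (Omega : measurableType d).
Context (G : forall n : nat, Omega -> rel 'I_n).
Context (Gsym : forall n w, symmetric (@G n w)).
Context (Gmeas : forall i : edge_index, measurable (edge_event G i)).

(** The endpoints are sorted because probabilities and independence are given for increasing pairs
    only. *)
Definition edge_of n (x v : 'I_n) : edge_index :=
  Tagged (fun n => 'I_n * 'I_n)%type
    (if (x < v)%N then (x, v) else (v, x)).

Lemma edge_event_edge_of n (x v : 'I_n) :
  edge_event G (edge_of x v) = [set w | @G n w x v].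
Proof.
rewrite /edge_event /edge_of; apply: eq_set => w /=.
by case: ifP => _ //=; rewrite Gsym.
Qed.

(** The set [A] tells the endpoints apart, so sorting them loses nothing. *)
Lemma edge_of_inj n (A : {set 'I_n}) (x x' v v' : 'I_n) :
  x \in A -> x' \in A -> v \notin A -> v' \notin A ->
  edge_of x v = edge_of x' v' -> (x, v) = (x', v').
Proof.
move=> xA x'A vA v'A /eqP; rewrite /edge_of eq_Tagged => /eqP /=.
by do 2 case: ifP => _; move=> [] *; subst => //; rewrite ?xA ?x'A in vA v'A.
Qed.

Lemma proper_edge_of n (x v : 'I_n) : x != v -> proper_pair (edge_of x v).
Proof.
rewrite /proper_pair /edge_of /= => xv; case: ifP => //= /negbT.
by rewrite -leqNgt leq_eqVlt => /orP[/eqP/val_inj|//] vx; rewrite vx eqxx in xv.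
Qed.

Definition ext_event n (A B : {set 'I_n}) (v : 'I_n) : set Omega :=
  [set w | [forall x in A, @G n w x v == (x \in B)]].

Lemma measurable_ext_event n (A B : {set 'I_n}) v : measurable (ext_event A B v).
Proof.
have -> : ext_event A B v = \bigcap_(x in [set` A])
    (if x \in B then edge_event G (edge_of x v)
     else ~` edge_event G (edge_of x v)).
  apply/seteqP; split => w /=.
    move=> /forall_inP h x /h; rewrite edge_event_edge_of.
    by case: (x \in B) => /eqP /= ->.
  move=> h; apply/forall_inP => x /h; rewrite edge_event_edge_of.
  by case: (x \in B) => /= [->//|/negP/negbTE ->].
apply: fin_bigcap_measurable; first exact: finite_finset.
by move=> x _; case: ifP => _ //; exact: measurableC.
Qed.

(** The intersection prescribes edges on [B] times [S] and non-edges on [A :\: B] times [S]. These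
    potential edges are pairwise distinct since [S] avoids [A]. *)
Lemma prob_ext_event (R : realType) (P : probability Omega R) (p : R) n
    (A B S : {set 'I_n}) :
  (forall i : edge_index, proper_pair i -> P (edge_event G i) = p%:E) ->
  mutually_independent P proper_pair (edge_event G) ->
  B \subset A -> S \subset ~: A ->
  P (\bigcap_(v in [set` S]) ext_event A B v)
    = ((p ^+ #|B| * (1 - p) ^+ #|A :\: B|) ^+ #|S|)%:E.
Proof.
move=> Gprob Gindep BA SA.
pose E (u : 'I_n * 'I_n) := edge_of u.1 u.2.
pose s := [seq E u | u <- enum (finset.setX B S)].
pose t := [seq E u | u <- enum (finset.setX (A :\: B) S)].
have st : s ++ t = [seq E u | u <- enum (finset.setX B S)
    ++ enum (finset.setX (A :\: B) S)] by rewrite map_cat.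
have stA u : u \in enum (finset.setX B S) ++ enum (finset.setX (A :\: B) S) ->
    (u.1 \in A) /\ (u.2 \notin A).
  rewrite mem_cat !mem_enum !inE => /orP[] /andP[].
    by move=> uB uS; rewrite (fintype.subsetP BA) //; have := fintype.subsetP SA _ uS; rewrite inE.
  by move=> /andP[_ uA] uS; rewrite uA; have := fintype.subsetP SA _ uS; rewrite inE.
have ust : uniq (s ++ t).
  rewrite st map_inj_in_uniq.
    rewrite cat_uniq !enum_uniq andbT /=; apply/hasPn => u.
    by rewrite !mem_enum !inE => /andP[/andP[/negbTE -> _] _].
  move=> [x v] [x' v'] /stA [/= xA vA] /stA [/= x'A v'A].
  exact: (edge_of_inj xA x'A vA v'A).
have Jst : all proper_pair (s ++ t).
  rewrite st all_map; apply/allP => u /stA [uA uA'] /=.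
  by apply: proper_edge_of; apply: contraNneq uA' => <-.
rewrite exprMn -!exprM -!cardsX !cardE -!(size_map E).
rewrite -(independent_complement Gmeas Gprob Gindep ust Jst).
congr (P _); rewrite -!bigcap_seq; apply/seteqP; split => w.
  move=> h; split => i /= /mapP[[x v]]; rewrite mem_enum !inE /= => /andP[].
    move=> xB vS ->; rewrite edge_event_edge_of /=.
    by have /forall_inP/(_ x (fintype.subsetP BA _ xB)) := h v vS; rewrite xB => /eqP ->.
  move=> /andP[xB xA] vS ->; rewrite edge_event_edge_of /=.
  by have /forall_inP/(_ x xA) := h v vS; rewrite (negbTE xB) => /eqP /= ->.
move=> [hs ht] v vS; apply/forall_inP => x xA.
have [xB|xB] := boolP (x \in B).
  have := hs (E (x, v)); rewrite /E edge_event_edge_of /= => -> //.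
  by apply/mapP; exists (x, v) => //; rewrite mem_enum !inE xB.
have := ht (E (x, v)); rewrite /E edge_event_edge_of /= => h.
apply/eqP/negbTE/negP; apply: h.
by apply/mapP; exists (x, v) => //; rewrite mem_enum !inE xB xA.
Qed.

End Extensions.

(** * Almost sure quasirandomness *)

Lemma ltpinfty_eseries (R : realType) (u : R^nat) :
  cvgn (series u) -> (\sum_(n <oo) (u n)%:E < +oo)%E.
Proof.
move=> cu.
have -> : (\sum_(n <oo) (u n)%:E)%E = (limn (series u))%:E.
  rewrite -EFin_lim //; congr (limn _); apply: funext => n.
  by rewrite /= /series /= sumEFin.
exact: ltry.
Qed.

Lemma summable_exp_decay (R : realType) (k : nat) (c : R) : 0 < c ->
  exists2 u : R^nat, cvgn (series u) &
    forall n, n%:R ^+ k * expR (- c * (n - k)%:R) <= u n.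
Proof.
(* Then [n <= a^-1 * expR (a * n)] and [k * a <= c / 2], so [n ^+ k] uses up at most half of the
   decay and a geometric series remains. The [k.+1] avoids a zero denominator at [k = 0]. *)
move=> c0; pose a := c / (2 * k.+1%:R).
have a0 : 0 < a by rewrite divr_gt0 // mulr_gt0.
pose D := (a^-1) ^+ k * expR (c * k%:R).
exists (geometric D (expR (- (c / 2)))).
  apply: is_cvg_geometric_series; rewrite ger0_norm ?expR_ge0 //.
  by rewrite -expR0 ltr_expR oppr_lt0 divr_gt0.
move=> n; rewrite /geometric /=.
have nk : n%:R - k%:R <= (n - k)%:R :> R.
  have [kn|/ltnW kn] := leqP k n; first by rewrite natrB.
  by rewrite (eqP kn) subr_le0 ler_nat.
have h1 : expR (- c * (n - k)%:R) <= expR (c * k%:R) * expR (- c * n%:R).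
  by rewrite -expRD ler_expR; nra.
have h2 : n%:R ^+ k <= (a^-1) ^+ k * expR (c / 2 * n%:R).
  apply: (@le_trans _ _ ((a^-1 * expR (a * n%:R)) ^+ k)).
    apply: lerXn2r; rewrite ?nnegrE ?ler0n //.
      by rewrite mulr_ge0 ?expR_ge0 // invr_ge0 ltW.
    rewrite mulrC ler_pdivlMr //.
    by apply: le_trans (expR_ge1Dx _); rewrite mulrC lerDr.
  rewrite exprMn -expRM_natl ler_pM2l ?exprn_gt0 ?invr_gt0 // ler_expR.
  rewrite mulrA ler_wpM2r // /a mulrA ler_pdivrMr ?mulr_gt0 //.
  have -> : c / 2 * (2 * k.+1%:R) = c * k.+1%:R by field.
  by rewrite mulrC ler_pM2l // ler_nat.
apply: le_trans (ler_pM _ _ h2 h1) _; rewrite ?exprn_ge0 ?expR_ge0 //.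
rewrite -expRM_natl /D -!mulrA ler_pM2l ?exprn_gt0 ?invr_gt0 //.
by rewrite -!expRD ler_expR; lra.
Qed.

Definition ext_by (T : finType) (E : rel T) (A B : {set T}) : pred T :=
  [pred v in ~: A | [forall x in A, E x v == (x \in B)]].

Definition quasirandom (R : realType) (p e : R) (k : nat) (T : finType)
    (E : rel T) : bool :=
  [forall A : {set T}, forall B : {set T}, (#|A| == k) && (B \subset A) ==>
    (`|#|ext_by E A B|%:R - p ^+ #|B| * (1 - p) ^+ #|A :\: B| * #|~: A|%:R|
      <= e * #|~: A|%:R)].

Lemma quasirandomP (R : realType) (p e : R) (k : nat) (T : finType)
    (E : rel T) :
  reflect (forall A B : {set T}, #|A| = k -> B \subset A ->
    `|#|ext_by E A B|%:R - p ^+ #|B| * (1 - p) ^+ #|A :\: B| * #|~: A|%:R|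
      <= e * #|~: A|%:R)
   (quasirandom p e k E).
Proof.
apply: (iffP forallP) => h A.
  by move=> B Ak BA; have /forallP/(_ B)/implyP := h A; apply; rewrite Ak eqxx.
by apply/forallP => B; apply/implyP => /andP[/eqP Ak BA]; exact: h.
Qed.

(** The number of terms in the union bound: for fixed [k] it is polynomial in the number of
    vertices, hence beaten by the exponential tail. *)
Lemma card_pairs_subset (T : finType) (k : nat) :
  (#|[pred u : {set T} * {set T} | (#|u.1| == k) && (u.2 \subset u.1)]|
    <= #|T| ^ k * 2 ^ k)%N.
Proof.
rewrite -sum1_card.
rewrite -(pair_big_dep (fun A : {set T} => #|A| == k)
  (fun A B : {set T} => B \subset A) (fun _ _ => 1%N)) /=.
apply: (@leq_trans (\sum_(A : {set T} | #|A| == k) 2 ^ k)).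
  apply: leq_sum => A /eqP <-; rewrite sum1_card -card_powerset.
  by apply: eq_leq; apply: eq_card => B; rewrite !inE.
rewrite sum_nat_cond_const leq_mul2r; apply/orP; right.
rewrite (_ : #|_| = 'C(#|T|, k)); last first.
  by rewrite -card_draws; apply: eq_card => A; rewrite !inE.
apply: (@leq_trans (#|T| ^_ k)); first by rewrite -bin_ffact leq_pmulr ?fact_gt0.
rewrite ffact_prod -[X in (_ <= _ ^ X)%N]card_ord -prod_nat_const.
by apply: leq_prod => i _; exact: leq_subr.
Qed.

Section AlmostSure.
Context (R : realType) (p : R) (hp0 : 0 < p) (hp1 : p < 1).
Context (d : measure_display) (Omega : measurableType d) (P : probability Omega R).
Context (G : forall n : nat, Omega -> rel 'I_n).
Context (Gsym : forall n w, symmetric (@G n w)).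
Context (Gmeas : forall i : edge_index, measurable (edge_event G i)).
Context (Gprob : forall i : edge_index, proper_pair i -> P (edge_event G i) = p%:E).
Context (Gindep : mutually_independent P proper_pair (edge_event G)).

Let not_quasirandom e k n : set Omega :=
  [set w | ~~ quasirandom p e k (@G n w)].

(** Union bound over the pairs [(A, B)], each contributing a Chernoff tail over the [n - k] vertices
    outside [A]. *)
Lemma prob_not_quasirandom (e : R) (k n : nat) : 0 < e <= 1 ->
  measurable (not_quasirandom e k n) /\
  (P (not_quasirandom e k n)
     <= ((2 ^+ k * 2) * (n%:R ^+ k * expR (- (e ^+ 2 / 8) * (n - k)%:R)))%:E)%E.
Proof.
move=> e01.
pose bad (u : {set 'I_n} * {set 'I_n}) := [set w | e * #|~: u.1|%:R
    < `|#|[pred v in ~: u.1 | w \in ext_event G u.1 u.2 v]|%:R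
        - p ^+ #|u.2| * (1 - p) ^+ #|u.1 :\: u.2| * #|~: u.1|%:R|].
have badP (u : {set 'I_n} * {set 'I_n}) : u.2 \subset u.1 -> measurable (bad u)
    /\ (P (bad u) <= (2 * expR (- (e ^+ 2 / 8) * #|~: u.1|%:R))%:E)%E.
  move=> u21; apply: chernoff => //.
  - by move=> v; exact: measurable_ext_event.
  - have [p0 p1] : 0 <= p /\ p <= 1 by split; exact: ltW.
    have [q0 q1] : 0 <= 1 - p /\ 1 - p <= 1 by rewrite subr_ge0 gerBl.
    by rewrite mulr_ge0 ?mulr_ile1 ?exprn_ge0 ?exprn_ile1.
  - by move=> S SC; exact: prob_ext_event.
pose Q := [pred u : {set 'I_n} * {set 'I_n} | (#|u.1| == k) && (u.2 \subset u.1)].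
have notE : not_quasirandom e k n = \bigcup_(u in [set` Q]) bad u.
  have eqc (u : {set 'I_n} * {set 'I_n}) w : #|[pred v in ~: u.1 | w \in ext_event G u.1 u.2 v]|
      = #|ext_by (@G n w) u.1 u.2|.
    apply: eq_card => v; rewrite !inE; congr (_ && _).
    by apply/idP/idP => [/set_mem //|h]; exact: mem_set.
  have badE u w : bad u w = (e * #|~: u.1|%:R < `|#|ext_by (@G n w) u.1 u.2|%:R
      - p ^+ #|u.2| * (1 - p) ^+ #|u.1 :\: u.2| * #|~: u.1|%:R|) :> Prop.
    by rewrite /bad /= eqc.
  apply/seteqP; split => w.
    move=> /forallPn[A] /forallPn[B]; rewrite negb_imply -ltNge => /andP[QAB h].
    by exists (A, B) => //; rewrite badE.
  case=> -[A B] /= QAB; rewrite badE /= => h.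
  apply/negP => /quasirandomP/(_ A B); case/andP: QAB => /eqP Ak BA.
  by move=> /(_ Ak BA); rewrite leNgt h.
have mnot : measurable (not_quasirandom e k n).
  rewrite notE; apply: fin_bigcup_measurable; first exact: finite_finset.
  by move=> u /andP[_ /badP[]].
split => //.
apply: (@le_trans _ _ (\sum_(u \in [set` Q]) P (bad u))%E).
  apply: content_sub_fsum => //.
  - by move=> u /andP[_ /badP[]].
  - by rewrite notE.
rewrite -(bigfs _ (index_enum_uniq _)); last by move=> u; rewrite mem_index_enum.
apply: (@le_trans _ _ (\sum_(u | Q u)
    (2 * expR (- (e ^+ 2 / 8) * (n - k)%:R))%:E)%E).
  apply: lee_sum => u /andP[/eqP uk /badP[_]].
  by rewrite cardsCs finset.setCK card_ord uk.
rewrite sumEFin lee_fin sumr_const -[leLHS]mulr_natl.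
have le := card_pairs_subset 'I_n k; rewrite card_ord -/Q in le.
rewrite (_ : 2 ^+ k * 2 * _ =
  (n ^ k * 2 ^ k)%:R * (2 * expR (- (e ^+ 2 / 8) * (n - k)%:R))).
  by rewrite ler_wpM2r ?ler_nat // mulr_ge0 ?expR_ge0.
by rewrite natrM !natrX; ring.
Qed.

(** Borel-Cantelli for each [k] and each tolerance of the form [j.+1%:R^-1]. These are countably
    many null sets, and an arbitrary real [e > 0] exceeds one of these tolerances. *)
Lemma ae_quasirandom :
  {ae P, forall w, forall (e : R) (k : nat), 0 < e ->
    \forall n \near \oo, quasirandom p e k (@G n w)}.
Proof.
have step (k j : nat) : {ae P, forall w,
    \forall n \near \oo, quasirandom p (j.+1%:R^-1) k (@G n w)}.
  pose e : R := j.+1%:R^-1.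
  have e01 : 0 < e <= 1 by rewrite invr_gt0 ltr0n invf_le1 ?ler1n ?ltr0n.
  have c0 : 0 < e ^+ 2 / 8.
    by rewrite divr_gt0 // exprn_gt0 //; case/andP: e01.
  have [u cu hu] := summable_exp_decay k c0.
  have PB n := prob_not_quasirandom k n e01.
  have u0 n : 0 <= u n.
    by apply: le_trans (hu n); rewrite mulr_ge0 ?exprn_ge0 ?expR_ge0.
  exists (lim_sup_set (not_quasirandom e k)); split.
  - by apply: bigcap_measurable => // i _; apply: bigcup_measurable => l _; case: (PB l).
  - apply: lim_sup_set_cvg0; first by move=> n; case: (PB n).
    apply: (@le_lt_trans _ _ (\sum_(n <oo) ((2 ^+ k * 2) * u n)%:E)%E).
      apply: lee_nneseries => // n _; apply: le_trans (PB n).2 _.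
      by rewrite lee_fin ler_wpM2l // mulr_ge0 ?exprn_ge0.
    apply: ltpinfty_eseries.
    exact: (is_cvg_seriesZ (k := 2 ^+ k * 2) cu).
  - move=> w /= nw i _; apply: contrapT => h; apply: nw.
    exists i => // n /= ni; apply/negP => /negP nq; apply: h.
    by exists n.
apply: filterS (ae_foralln (fun k => ae_foralln (step k))).
move=> w hw e k e0.
have [j je] : exists j : nat, j.+1%:R^-1 <= e.
  exists (Num.truncn e^-1); rewrite -[leRHS]invrK lef_pV2 ?posrE ?invr_gt0 ?ltr0n //.
  by rewrite ltW // truncnS_gt.
apply: filterS (hw k j) => n /quasirandomP h; apply/quasirandomP => A B Ak BA.
by apply: le_trans (h A B Ak BA) _; rewrite ler_wpM2r.
Qed.

End AlmostSure.

(** * Back-and-forth *)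

(** Bound variables count too, since the back-and-forth must update them as well. *)
Fixpoint var_bound (phi : formula) : nat :=
  match phi with
  | FTrue | FFalse => 0
  | FAdj a b | FEq a b => maxn a.+1 b.+1
  | FNot f => var_bound f
  | FAnd f g | FOr f g | FImp f g => maxn (var_bound f) (var_bound g)
  | FEx y f | FAll y f => maxn y.+1 (var_bound f)
  end.

Definition extension_property (N : nat) (T : finType) (E : rel T) : Prop :=
  forall A B : {set T}, (#|A| <= N)%N -> B \subset A ->
    exists v, v \in ext_by E A B.

(** A partial isomorphism between the assigned values. [FEq x x] holds exactly when [x] is assigned,
    so both assignments also have the same domain below [N]. *)
Definition same_atoms (N : nat) (T T' : finType) (E : rel T) (E' : rel T')
    (e : nat -> option T) (e' : nat -> option T') : Prop :=
  forall x y, (x < N)%N -> (y < N)%N ->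
    sat E e (FAdj x y) = sat E' e' (FAdj x y) /\
    sat E e (FEq x y) = sat E' e' (FEq x y).

Lemma same_atoms_sym N (T T' : finType) (E : rel T) (E' : rel T') e e' :
  same_atoms N E E' e e' -> same_atoms N E' E e' e.
Proof. by move=> h x y xN yN; have [-> ->] := h x y xN yN. Qed.

Lemma same_atoms_forth N (T T' : finType) (E : rel T) (E' : rel T') e e' y t :
  symmetric E -> irreflexive E -> symmetric E' -> irreflexive E' ->
  extension_property N E' -> same_atoms N E E' e e' ->
  (y < N)%N -> exists t', same_atoms N E E' (upd e y t) (upd e' y t').
Proof.
move=> Es Ei E's E'i ext ee' yN.
have def x : (x < N)%N -> e x = e' x :> bool.
  move=> xN; have [_] /= := ee' x x xN xN.
  by case: (e x) (e' x) => [u|] [u'|]; rewrite ?eqxx.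
(* If [t] is already the value of some variable [z], the answer is the value of [z] on the other
   side, and updating [y] amounts to renaming it to [z]. *)
have [[z [zN ez]]|nez] := pselect (exists z, (z < N)%N /\ e z = Some t).
- have [t' e'z] : exists t', e' z = Some t'.
    by have := def z zN; rewrite ez; case: (e' z) => // t' _; exists t'.
  exists t' => a b aN bN.
  pose r x := if x == y then z else x.
  have rN x : (x < N)%N -> (r x < N)%N by rewrite /r; case: ifP.
  have ur x : upd e y t x = e (r x) by rewrite /upd /r; case: ifP.
  have ur' x : upd e' y t' x = e' (r x) by rewrite /upd /r; case: ifP.
  by have := ee' (r a) (r b) (rN a aN) (rN b bN); rewrite /= !ur !ur'.
(* Otherwise the extension property yields a fresh [t'] joined, among the values [A'] of the other
   assignment, exactly to the counterparts [B'] of the neighbours of [t]. *)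
pose A' := [set u' | [exists z : 'I_N, e' z == Some u']]%SET.
pose B' := [set u' in A' | [exists z : 'I_N, (e' z == Some u') &&
  (if e z is Some u then E u t else false)]]%SET.
have A'N : (#|A'| <= N)%N.
  rewrite -(card_imset _ (fun x y : T' => @Some_inj _ x y)) -[X in (_ <= X)%N]card_ord.
  apply: leq_trans (leq_imset_card (fun z : 'I_N => e' z) _).
  apply/subset_leq_card/fintype.subsetP => o /imsetP[u'].
  by rewrite inE => /existsP[z /eqP e'z] ->; apply/imsetP; exists z.
have [t' ] : exists v, v \in ext_by E' A' B'.
  by apply: ext => //; apply/fintype.subsetP => u'; rewrite inE => /andP[].
rewrite !inE => /andP[t'A /forall_inP t'B]; exists t'.
have step x : (x < N)%N -> x != y ->
    match e x, e' x with
    | Some u, Some u' => [/\ E u t = E' u' t', t == u = false & t' == u' = false]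
    | None, None => True | _, _ => False end.
  move=> xN xy; move: (def x xN).
  case ex: (e x) => [u|]; case e'x: (e' x) => [u'|] // _.
  have u'A : u' \in A'.
    by rewrite inE; apply/existsP; exists (Ordinal xN); rewrite /= e'x.
  split; last 2 first.
  - by apply/negP => /eqP tu; apply: nez; exists x; rewrite ex tu.
  - apply/negP => /eqP t'u; move/negP: t'A; apply; apply/existsP.
    by exists (Ordinal xN); rewrite /= e'x t'u.
  (* Variables equal under [e'] are equal under [e] by the equality atoms, so membership in [B']
     does not depend on the variable representing [u']. *)
  rewrite (eqP (t'B _ u'A)) finset.in_set u'A /=.
  apply/idP/existsP => [Eut|[z /andP[/eqP e'z]]].
    by exists (Ordinal xN); rewrite /= e'x ex eqxx.
  case ez: (e z) => [v|//] Evt.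
  have [_] /= := ee' z x (ltn_ord z) xN.
  by rewrite ez ex e'z e'x eqxx => /eqP <-.
move=> a b aN bN; rewrite /= /upd.
have [_|ay] := eqVneq a y; have [_|by_] := eqVneq b y.
- by rewrite Ei E'i !eqxx.
- have := step b bN by_; case: (e b) (e' b) => [u|] [u'|] // [Eu tu tu'].
  by rewrite Es Eu E's tu tu'.
- have := step a aN ay; case: (e a) (e' a) => [u|] [u'|] // [Eu tu tu'].
  by rewrite Eu eq_sym tu eq_sym tu'.
- exact: ee'.
Qed.

(* Only the number of variables matters, not the quantifier rank: an assignment
   of N variables involves at most N vertices, whatever is requantified. *)
Lemma sat_same_atoms N (T T' : finType) (E : rel T) (E' : rel T') phi e e' :
  symmetric E -> irreflexive E -> symmetric E' -> irreflexive E' ->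
  extension_property N E -> extension_property N E' ->
  (var_bound phi <= N)%N -> same_atoms N E E' e e' ->
  sat E e phi = sat E' e' phi.
Proof.
move=> Es Ei E's E'i ext ext'.
have back := same_atoms_forth _ E's E'i Es Ei ext.
have forth := same_atoms_forth _ Es Ei E's E'i ext'.
elim: phi e e' => [||a b|a b|f IH|f IHf g IHg|f IHf g IHg|f IHf g IHg|y f IH|y f IH]
  e e' //=; rewrite ?geq_max.
- by move=> /andP[aN bN] /(_ a b aN bN)[].
- by move=> /andP[aN bN] /(_ a b aN bN)[].
- by move=> fN ee'; rewrite (IH e e').
- by move=> /andP[fN gN] ee'; rewrite (IHf e e') // (IHg e e').
- by move=> /andP[fN gN] ee'; rewrite (IHf e e') // (IHg e e').
- by move=> /andP[fN gN] ee'; rewrite (IHf e e') // (IHg e e').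
- move=> /andP[yN fN] ee'; apply/existsP/existsP => -[t ht].
    by have [t' h] := forth _ _ _ t ee' yN; exists t'; rewrite -(IH _ _ fN h).
  have [t' h] := back _ _ _ t (same_atoms_sym ee') yN; exists t'.
  by rewrite (IH _ _ fN (same_atoms_sym h)).
- move=> /andP[yN fN] ee'; apply/forallP/forallP => ht t.
    have [t' h] := back _ _ _ t (same_atoms_sym ee') yN.
    by rewrite -(IH _ _ fN (same_atoms_sym h)).
  by have [t' h] := forth _ _ _ t ee' yN; rewrite (IH _ _ fN h).
Qed.

(** * Densities of adjacency types *)

(* Adjacency type of a tuple of vertices: the rows of the upper triangular part
   of its adjacency matrix. *)
Fixpoint code (T : Type) (E : rel T) (s : seq T) : seq (seq bool) :=
  if s is x :: s' then [seq E x y | y <- s'] :: code E s' else [::].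

Lemma size_code (T : Type) (E : rel T) s : size (code E s) = size s.
Proof. by elim: s => //= x s ->. Qed.

Lemma code_nth (T T' : Type) (E : rel T) (E' : rel T') x0 x0' s s' i j :
  code E s = code E' s' -> (i < j < size s)%N ->
  E (nth x0 s i) (nth x0 s j) = E' (nth x0' s' i) (nth x0' s' j).
Proof.
elim: s s' i j => [|x s IHs] [|x' s'] [|i] [|j] //=; rewrite ?andbF //.
  move=> [eh et]; rewrite ltnS => jn.
  have jn' : (j < size s')%N by rewrite -(size_code E') -et size_code.
  by rewrite -(nth_map x0 false (E x)) // eh (nth_map x0').
by move=> [_ et]; rewrite !ltnS => ij; exact: IHs.
Qed.

(** Symmetry and irreflexivity recover the entries on and below the diagonal, and distinctness
    settles the equalities. *)
Lemma same_atoms_onth N (T T' : finType) (E : rel T) (E' : rel T') s s' :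
  symmetric E -> irreflexive E -> symmetric E' -> irreflexive E' ->
  uniq s -> uniq s' -> code E s = code E' s' ->
  same_atoms N E E' (onth s) (onth s').
Proof.
move=> Es Ei E's E'i us us' ss'.
have sz : size s = size s' by rewrite -(size_code E) ss' size_code.
have onthP (U : Type) (r : seq U) i : (i < size r)%N ->
    exists u0, onth r i = Some (nth u0 r i).
  case: r => // u r ir; exists u.
  by rewrite onthE (nth_map u).
have onthN (U : Type) (r : seq U) i : (size r <= i)%N -> onth r i = None.
  by move=> ir; rewrite onthE nth_default ?size_map.
move=> a b _ _ /=.
have [sa|as_] := leqP (size s) a.
  by rewrite !(onthN _ _ a) -?sz.
have [sb|bs] := leqP (size s) b.
  by rewrite !(onthN _ _ b) -?sz //; case: (onth s a); case: (onth s' a).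
have [u0 _] := onthP _ _ _ as_.
have [u0' _] : exists u0', onth s' a = Some (nth u0' s' a) by apply: onthP; rewrite -sz.
rewrite !onthE !(nth_map u0) // !(nth_map u0') -?sz //.
split; last by rewrite !nth_uniq -?sz.
have [ab|ba|->] := ltngtP a b.
- by apply: code_nth => //; rewrite ab.
- by rewrite Es E's; apply: code_nth => //; rewrite ba.
- by rewrite Ei E'i.
Qed.

Lemma card_tuple_cons (T : finType) (q : nat) (Q : pred (seq T)) :
  #|[pred s : q.+1.-tuple T | Q s]|
    = \sum_(s : q.-tuple T) #|[pred x : T | Q (x :: s)]|.
Proof.
rewrite -sum1_card (reindex (fun u : q.-tuple T * T => [tuple of u.2 :: u.1])) /=.
  under [RHS]eq_bigr => s _ do rewrite -sum1_card.
  by rewrite pair_big_dep.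
exists (fun t : q.+1.-tuple T => ([tuple of behead t], thead t)) => [[s x]|t] _ /=.
  by congr (_, _); apply: val_inj.
by rewrite -tuple_eta.
Qed.

(** Tuples are built by prepending a vertex [x] to [s]; they are sorted by the row [a] that [x] adds
    to the code. *)
Lemma card_tuple_code (T : finType) (E : rel T) (q : nat)
    (f : pred (seq (seq bool))) :
  #|[pred s : q.+1.-tuple T | uniq s && f (code E s)]|
    = \sum_(a : q.-tuple bool)
        \sum_(s : q.-tuple T | uniq s && f (tval a :: code E s))
          #|[pred x | (x \notin s) && ([seq E x y | y <- s] == a)]|.
Proof.
rewrite (card_tuple_cons _ (fun s => uniq s && f (code E s))).
under [RHS]eq_bigr => a _ do rewrite big_mkcond.
rewrite exchange_big; apply: eq_bigr => s _ /=.
rewrite -sum1_card (partition_big (fun x => [tuple of [seq E x y | y <- s]]) xpredT) //=.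
apply: eq_bigr => a _; rewrite sum1_card.
case: ifP => [/andP[us fa]|nus].
  apply: eq_card => x; rewrite unfold_in !inE us andbT -val_eqE /=.
  case: eqP => [->|_]; last by rewrite !andbF.
  by rewrite fa !andbT.
rewrite -[RHS](card0 T); apply: eq_card => x; rewrite unfold_in !inE -val_eqE /=.
case: eqP => [->|_]; last by rewrite andbF.
by rewrite andbT -andbA nus andbF.
Qed.

Lemma card_neighbour_pattern (T : finType) (E : rel T) (q : nat) (s : q.-tuple T)
    (a : q.-tuple bool) : symmetric E -> uniq s ->
  exists A B : {set T}, [/\ #|A| = q, B \subset A, #|B| = count id a &
    #|[pred x | (x \notin s) && ([seq E x y | y <- s] == a)]| = #|ext_by E A B|].
Proof.
move=> Es us.
pose A := [set x in s]%SET; pose B := [set x in s | nth false a (index x s)]%SET.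
exists A, B; split.
- by rewrite cardsE (card_uniqP us) size_tuple.
- by apply/fintype.subsetP => x; rewrite !inE => /andP[].
- rewrite cardsE.
  have /eq_card -> : [pred x in s | nth false a (index x s)]
      =i [seq x <- s | nth false a (index x s)].
    by move=> x; rewrite mem_filter andbC inE.
  rewrite (card_uniqP (filter_uniq _ us)) size_filter.
  (* As [s] has no repetition, reading membership in [B] along [s] gives back [a], so [B] has as
     many elements as [a] has entries [true]. *)
  rewrite -{2}(_ : [seq nth false a (index x s) | x <- s] = a) ?count_map //.
  apply: (@eq_from_nth _ false); rewrite size_map ?size_tuple // => i iq.
  case: (tval s) us (size_tuple s) iq => [|x0 s'] us' sz iq; first by rewrite -sz in iq.
  by rewrite (nth_map x0) ?sz // index_uniq ?sz.
apply: eq_card => x; rewrite !inE; congr (_ && _).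
have sza : size a = size s by rewrite !size_tuple.
apply/eqP/forall_inP => [Exs y|h].
  rewrite inE => ys; rewrite !inE ys -Exs /= Es.
  by rewrite (nth_map y) ?index_mem // nth_index.
apply: (@eq_from_nth _ false); rewrite size_map // => i iq.
rewrite (nth_map x) // Es.
have xs : nth x s i \in s by rewrite mem_nth.
rewrite (eqP (h (nth x s i) _)); last by rewrite inE.
by rewrite inE xs index_uniq.
Qed.

(** Quasirandomness compares with the [#|T| - q] vertices outside the tuple; replacing this by
    [#|T|] costs at most [q]. *)
Lemma card_neighbour_pattern_approx (R : realType) (p e : R) (T : finType)
    (E : rel T) (q : nat) (s : q.-tuple T) (a : q.-tuple bool) :
  0 <= p <= 1 -> 0 <= e -> symmetric E -> quasirandom p e q E -> uniq s ->
  `|#|[pred x | (x \notin s) && ([seq E x y | y <- s] == a)]|%:R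
     - p ^+ count id a * (1 - p) ^+ (q - count id a) * #|T|%:R|
    <= e * #|T|%:R + q%:R.
Proof.
move=> /andP[p0 p1] e0 Es /quasirandomP qr us.
have [A [B [Aq BA Ba ->]]] := card_neighbour_pattern a Es us.
have := qr A B Aq BA.
rewrite cardsDS // Ba Aq; set pa := p ^+ _ * _.
have pa01 : 0 <= pa <= 1.
  by rewrite mulr_ge0 ?mulr_ile1 ?exprn_ge0 ?exprn_ile1 ?subr_ge0 ?gerBl.
have qT : (q <= #|T|)%N by rewrite -Aq max_card.
rewrite -[#|T|%:R](subrK q%:R) -(natrB _ qT) -Aq cardsCs finset.setCK Aq.
set m : R := (_ - _)%:R; set x : R := #|_|%:R => h.
have m0 : 0 <= m by rewrite ler0n.
have q0 : 0 <= q%:R :> R by rewrite ler0n.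
rewrite mulrDr opprD addrA.
apply: le_trans (ler_normB _ _) _.
have paq : `|pa * q%:R| <= q%:R.
  by case/andP: pa01 => *; rewrite ger0_norm; [apply: ler_piMl|apply: mulr_ge0].
by apply: le_trans (lerD h paq) _; rewrite mulrDr lerD2r lerDl mulr_ge0.
Qed.

Section Density.
Context (R : realType).

(** Only repetition-free tuples are counted, but the normalisation is by all tuples, as in
    [stone]. *)
Definition density (q : nat) (f : pred (seq (seq bool))) (T : finType)
    (E : rel T) : R :=
  #|[pred s : q.-tuple T | uniq s && f (code E s)]|%:R / #|T|%:R ^+ q.

(** There are [2 ^+ q] rows and at most [#|T| ^ q] tails, each pair giving an error at most
    [e * #|T| + q]; division by [#|T| ^ q.+1] gives the bound. *)
Lemma density_step (p e : R) (T : finType) (E : rel T) (q : nat)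
    (f : pred (seq (seq bool))) :
  0 <= p <= 1 -> 0 <= e -> symmetric E -> quasirandom p e q E -> (0 < #|T|)%N ->
  `|density q.+1 f E - \sum_(a : q.-tuple bool)
       p ^+ count id a * (1 - p) ^+ (q - count id a)
         * density q (fun l => f (tval a :: l)) E|
    <= 2 ^+ q * (e + q%:R / #|T|%:R).
Proof.
move=> p01 e0 Es qr T0.
set n : R := #|T|%:R; have n0 : 0 < n by rewrite ltr0n.
have nq0 : 0 < n ^+ q by rewrite exprn_gt0.
rewrite -(ler_pM2r (x := n ^+ q.+1)) ?exprn_gt0 //.
rewrite -[X in `|_| * X](ger0_norm (exprn_ge0 _ (ltW n0))) -normrM.
rewrite mulrBl mulr_suml {1}/density divfK ?gt_eqF ?exprn_gt0 //.
rewrite card_tuple_code natr_sum -sumrB.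
have -> : 2 ^+ q * (e + q%:R / n) * n ^+ q.+1
    = \sum_(a : q.-tuple bool) n ^+ q * (e * n + q%:R).
  rewrite sumr_const card_tuple card_bool -[RHS]mulr_natl natrX exprS.
  by field; rewrite gt_eqF.
apply: le_trans (ler_norm_sum _ _ _) _; apply: ler_sum => a _.
rewrite /density -/n exprS.
set S := [pred s : q.-tuple T | _]; set pa := p ^+ _ * _.
have -> : pa * (#|S|%:R / n ^+ q) * (n * n ^+ q) = \sum_(s in S) pa * n.
  by rewrite sumr_const -[RHS]mulr_natl; field; rewrite gt_eqF.
rewrite natr_sum (eq_bigl (mem S)) // -sumrB.
apply: le_trans (ler_norm_sum _ _ _) _.
apply: (@le_trans _ _ (\sum_(s in S) (e * n + q%:R))).
  by apply: ler_sum => s /andP[us _]; exact: card_neighbour_pattern_approx.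
rewrite sumr_const -[leLHS]mulr_natl ler_wpM2r //.
  by rewrite addr_ge0 // mulr_ge0 // ltW.
by rewrite -natrX ler_nat -card_tuple max_card.
Qed.

(** Induction on [q] for all [f] at once, since the recursion replaces [f] by its sections
    [fun l => f (tval a :: l)]. Up to a vanishing error the density is a fixed linear combination of
    convergent ones. *)
Lemma density_cvg (p : R) (G : forall n, rel 'I_n) (q : nat)
    (f : pred (seq (seq bool))) :
  0 <= p <= 1 -> (forall n, symmetric (@G n)) ->
  (forall (e : R) (k : nat), 0 < e ->
     \forall n \near \oo, quasirandom p e k (@G n)) ->
  cvgn (fun n => density q f (@G n)).
Proof.
move=> p01 Gs qr; elim: q f => [|q IHq] f.
  apply: (@is_cvg_near_cst nat R (f [::])%:R).
  apply: nearW => n; rewrite /density expr0 divr1; congr (_%:R).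
  rewrite -sum1_card big_mkcond (big_pred1 [tuple]) /=; last by move=> s; apply/esym/eqP; exact: tuple0.
  by case: ifP => [|]; rewrite inE /= => ->.
pose c n := \sum_(a : q.-tuple bool)
  p ^+ count id a * (1 - p) ^+ (q - count id a)
    * density q (fun l => f (tval a :: l)) (@G n).
have cc : cvgn c.
  apply/cvg_ex; exists (\sum_(a : q.-tuple bool)
    p ^+ count id a * (1 - p) ^+ (q - count id a)
      * limn (fun n => density q (fun l => f (tval a :: l)) (@G n))).
  apply: cvg_big => [|a _]; first exact: add_continuous.
  by apply: cvgMl_tmp; exact: IHq.
suff dc : (fun n => density q.+1 f (@G n) - c n) @ \oo --> 0.
  have -> : (fun n => density q.+1 f (@G n))
      = (fun n => (density q.+1 f (@G n) - c n) + c n).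
    by apply: funext => n; rewrite subrK.
  by apply: is_cvgD => //; apply/cvg_ex; exists 0.
apply/cvgr0Pnorm_le => eps eps0.
(* One half of [eps] is for the tolerance, the other for [q%:R / n%:R], both multiplied by
   [2 ^+ q]. *)
pose e := eps / 2 / 2 ^+ q.
have e0 : 0 < e by rewrite !divr_gt0 ?exprn_gt0.
near=> n.
have n0 : (0 < n)%N by near: n; exact: nbhs_infty_gt.
apply: le_trans (density_step f p01 (ltW e0) (Gs n) _ _) _; rewrite ?card_ord //.
  by near: n; exact: qr.
have : q%:R / n%:R <= e.
  rewrite ler_pdivrMr ?ltr0n // mulrC -ler_pdivrMr //.
  by near: n; exact: nbhs_infty_ger.
have -> : eps = 2 ^+ q * (e + e).
  by rewrite /e; field; rewrite gt_eqF ?exprn_gt0.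
by move=> h; rewrite ler_wpM2l ?exprn_ge0 // lerD2l.
Unshelve. all: by end_near. Qed.

End Density.

(** Tuples with repetitions are negligible: passing from [q] to [q.+1] multiplies the ratio by
    [1 - q / n], which tends to 1. *)
Lemma cvg_ffact_ratio (R : realType) (q : nat) :
  (fun n : nat => (n ^_ q)%:R / n%:R ^+ q : R) @ \oo --> (1 : R).
Proof.
elim: q => [|q IHq].
  rewrite (_ : (fun n => _) = cst 1); first exact: cvg_cst.
  by apply: funext => n; rewrite ffactn0 expr0 divr1.
have h : (fun n : nat => 1 - q%:R / n%:R : R) @ \oo --> (1 - 0 : R).
  apply: cvgB; first exact: cvg_cst.
  rewrite -(mulr0 (q%:R : R)); apply: cvgMl_tmp.
  have npos : \forall n \near \oo, 0 < n%:R :> R.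
    by exists 1%N => // n /= n0; rewrite ltr0n.
  exact: (gtr0_cvgV0 npos).2 cvgr_idn.
rewrite subr0 in h.
suff: (fun n : nat => (n ^_ q.+1)%:R / n%:R ^+ q.+1 : R) @ \oo --> (1 * 1 : R).
  by rewrite mulr1.
apply: cvg_trans (cvgM IHq h); apply: near_eq_cvg; near=> n.
have n0 : (0 < n)%N by near: n; exact: nbhs_infty_gt.
have qn : (q <= n)%N by near: n; exact: nbhs_infty_ge.
rewrite /= ffactnSr natrM natrB // exprSr.
have x0 : n%:R != 0 :> R by rewrite pnatr_eq0 -lt0n.
by field; rewrite ?expf_neq0 x0.
Unshelve. all: by end_near. Qed.

(** * Convergence *)

(** Every expected proportion is at least [Num.min p (1 - p) ^+ k]; a tolerance of half of that
    keeps the count positive. *)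
Lemma quasirandom_ext_by (R : realType) (p : R) (k : nat) (T : finType)
    (E : rel T) (A B : {set T}) :
  0 < p < 1 -> quasirandom p (Num.min p (1 - p) ^+ k / 2) k E ->
  #|A| = k -> (k < #|T|)%N -> B \subset A -> exists v, v \in ext_by E A B.
Proof.
move=> /andP[p0 p1] /quasirandomP qr Ak kT BA.
have := qr A B Ak BA; rewrite cardsDS // Ak.
set r := Num.min p (1 - p); set m : R := #|~: A|%:R; set pa := p ^+ _ * _.
have r0 : 0 < r by rewrite lt_min p0 subr_gt0.
have m0 : 0 < m by rewrite ltr0n cardsCs finset.setCK Ak subn_gt0.
have Bk : (#|B| <= k)%N by rewrite -Ak subset_leq_card.
have rpa : r ^+ k <= pa.
  rewrite -[X in r ^+ X](subnKC Bk) exprD.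
  have rp : r <= p by rewrite ge_min lexx.
  have rq : r <= 1 - p by rewrite ge_min lexx orbT.
  have rn := ltW r0.
  by apply: ler_pM; rewrite ?exprn_ge0 // lerXn2r ?nnegrE // (le_trans rn).
have rk0 : 0 < r ^+ k by rewrite exprn_gt0.
rewrite ler_distl => /andP[h _].
apply/existsP; apply: contraLR h; rewrite negb_exists => /forallP h.
rewrite (_ : #|ext_by E A B| = 0%N); last first.
  by rewrite eq_card0 // => v; exact/negbTE/h.
rewrite -ltNge -mulrBl mulr_gt0 //; lra.
Qed.

Lemma near_extension_property (R : realType) (p : R) (G : forall n, rel 'I_n)
    (N : nat) :
  0 < p < 1 ->
  (forall (e : R) (k : nat), 0 < e ->
     \forall n \near \oo, quasirandom p e k (@G n)) ->
  \forall n \near \oo, extension_property N (@G n).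
Proof.
move=> p01 qr.
have r0 : 0 < Num.min p (1 - p).
  by case/andP: p01 => p0 p1; rewrite lt_min p0 subr_gt0.
have step k : \forall n \near \oo, forall A B : {set 'I_n}, #|A| = k ->
    B \subset A -> exists v, v \in ext_by (@G n) A B.
  near=> n => A B Ak BA; apply: (quasirandom_ext_by p01 _ Ak) => //.
    by near: n; apply: qr; rewrite divr_gt0 ?exprn_gt0.
  by rewrite card_ord; near: n; exact: nbhs_infty_gt.
elim: N => [|N IHN].
  apply: filterS (step 0%N) => n h A B; rewrite leqn0 => /eqP; exact: h.
apply: filterS2 IHN (step N.+1) => n h1 h2 A B.
by rewrite leq_eqVlt => /orP[/eqP|]; [exact: h2|exact: h1].
Unshelve. all: by end_near. Qed.

Lemma env_of_tuple (T : Type) (q : nat) (s : q.-tuple T) :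
  env_of (finfun_of_tuple s) =1 onth s.
Proof.
move=> i; rewrite /env_of onthE; case: insubP => [j _ <-|].
  rewrite (nth_map (tnth s j)) ?size_tuple; last exact: ltn_ord.
  by congr Some; rewrite ffunE; exact: tnth_nth.
by rewrite -leqNgt => qi; rewrite nth_default // size_map size_tuple.
Qed.

Lemma stone_tuple (R : realType) (q : nat) (phi : formula) (T : finType)
    (E : rel T) :
  stone R q phi E
    = #|[pred s : q.-tuple T | sat E (onth s) phi]|%:R / #|T|%:R ^+ q.
Proof.
rewrite /stone natrX; congr (_%:R / _).
have inj : injective (@finfun_of_tuple T q).
  exact: can_inj (@finfun_of_tupleK T q).
rewrite -(fintype.card_image inj); apply: eq_card => v.
apply/idP/fintype.imageP => [|[s]].
  rewrite inE /= => sv; exists (tuple_of_finfun v); rewrite ?tuple_of_finfunK //.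
  by rewrite inE -(funext (env_of_tuple _)) tuple_of_finfunK.
by rewrite inE => ss ->; rewrite inE /= (funext (env_of_tuple _)).
Qed.

Lemma quasirandom_FO_convergent (R : realType) (p : R) (G : forall n, rel 'I_n) :
  0 < p < 1 ->
  (forall n, symmetric (@G n)) -> (forall n, irreflexive (@G n)) ->
  (forall (e : R) (k : nat), 0 < e ->
     \forall n \near \oo, quasirandom p e k (@G n)) ->
  FO_convergent R G.
Proof.
move=> p01 Gs Gi qr q phi _.
have [n0 _ ext] := near_extension_property (var_bound phi) p01 qr.
(* The codes realised by a satisfying tuple in some late graph. By back-and-forth, all realisations
   of a code in late graphs agree on [phi], so one of them decides. *)
pose f (l : seq (seq bool)) : bool := `[< exists n (s : seq 'I_n),
  [/\ (n0 <= n)%N, uniq s, code (@G n) s = l & sat (@G n) (onth s) phi] >].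
have satf n (s : seq 'I_n) : (n0 <= n)%N -> uniq s ->
    sat (@G n) (onth s) phi = f (code (@G n) s).
  move=> n0n us; apply/idP/asboolP => [ss|[m [t [n0m ut tc ts]]]].
    by exists n, s.
  rewrite -(sat_same_atoms (Gs m) (Gi m) (Gs n) (Gi n) (ext m n0m) (ext n n0n)
    (leqnn _) (e := onth t)) //.
  exact: (same_atoms_onth (Gs m) (Gi m) (Gs n) (Gi n) ut us tc).
have p01' : 0 <= p <= 1 by case/andP: p01 => /ltW -> /ltW ->.
have /cvg_ex[l dl] := density_cvg (q := q) (f := f) p01' Gs qr.
pose rest n : R := stone R q phi (@G n) - density R q f (@G n).
have rest0 : rest @ \oo --> 0.
  have h : (fun n : nat => 1 - (n ^_ q)%:R / n%:R ^+ q : R) @ \oo --> (0 : R).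
    rewrite -(subrr (1 : R)); apply: cvgB; first exact: cvg_cst.
    exact: cvg_ffact_ratio.
  (* Past [n0] the two counts differ exactly by the satisfying tuples with repetitions, of which
     there are at most [n ^ q - n ^_ q]. *)
  apply: (squeeze_cvgr _ (cvg_cst 0) h); near=> n.
  have n0n : (n0 <= n)%N by near: n; exact: nbhs_infty_ge.
  have n1 : (0 < n)%N by near: n; exact: nbhs_infty_gt.
  have nq0 : 0 < n%:R ^+ q :> R by rewrite exprn_gt0 // ltr0n.
  rewrite /rest stone_tuple /density card_ord.
  set a := #|_|; set b := #|_|.
  have ab : a = (b + #|[pred s : q.-tuple 'I_n
      | ~~ uniq s && sat (@G n) (onth s) phi]|)%N.
    rewrite /a /b -(cardID [pred s : q.-tuple 'I_n | uniq s]); congr addn.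
    apply: fintype.eq_card => s; rewrite !inE; case us: (uniq s) => /=.
      by rewrite andbT -satf.
    by rewrite andbF.
  have bn : (#|[pred s : q.-tuple 'I_n
      | ~~ uniq s && sat (@G n) (onth s) phi]| + n ^_ q <= n ^ q)%N.
    have -> : (n ^ q = #|{: q.-tuple 'I_n}|)%N by rewrite card_tuple card_ord.
    have -> : n ^_ q = #|[pred s : q.-tuple 'I_n | uniq s]|.
      rewrite -[in LHS](card_ord n) -(card_uniq_tuples q 'I_n) cardsE.
      by apply: fintype.eq_card => s; rewrite unfold_in /= inE (introT allP).
    rewrite -(cardID [pred s : q.-tuple 'I_n | uniq s] {: q.-tuple 'I_n}) addnC.
    apply: leq_add; apply/subset_leq_card/fintype.subsetP => s; rewrite !inE.
      by move=> ->.
    by case/andP => ->.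
  rewrite -mulrBl ab natrD addrAC subrr add0r divr_ge0 ?(ltW nq0) //=.
  rewrite ler_pdivrMr // mulrBl mul1r divfK ?gt_eqF // lerBrDr.
  by rewrite -natrD -natrX ler_nat.
apply/cvg_ex; exists (0 + l).
rewrite (_ : (fun n => _) = (fun n => rest n + density R q f (@G n))).
  exact: cvgD.
by apply: funext => n; rewrite /rest subrK.
Unshelve. all: by end_near. Qed.

Theorem theorem5p14 (R : realType) (p : R) (hp0 : 0 < p) (hp1 : p < 1)
  (d : measure_display) (Omega : measurableType d) (P : probability Omega R)
  (G : forall n : nat, Omega -> rel 'I_n)
  (Gsym : forall n w, symmetric (G n w))
  (Girr : forall n w, irreflexive (G n w))
  (Gmeas : forall i : edge_index, measurable (edge_event G i))
  (Gprob : forall i : edge_index, proper_pair i -> P (edge_event G i) = p%:E)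
  (Gindep : mutually_independent P proper_pair (edge_event G)) :
  {ae P, forall w, FO_convergent R (fun n => G n w)}.
Proof.
apply: filterS (ae_quasirandom hp0 hp1 Gsym Gmeas Gprob Gindep) => w qr.
by apply: quasirandom_FO_convergent qr => //; rewrite hp0.
Qed.
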